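(* Let $p$ be a prime number and $R\cong\mathbb Z_p\times\mathbb Z_p\times\mathbb Z_p\times\mathbb Z_p$. Put $$\lambda_1 = (p-1)^2,\qquad \lambda_2 = -p^2+2p-1,$$ $$\lambda_{3,4} = \tfrac12\big(-2p^2+3p-1\pm(p-1)\sqrt{4p-3}\big),$$ $$\lambda_{5,6} = \tfrac12\big(2p^2-p-1\pm\sqrt3\,\sqrt{4p^3-9p^2+6p-1}\big).$$ Then the spectrum (multiset of eigenvalues) of the zero-divisor graph $\Gamma(R)$ is $$\operatorname{spec}(\Gamma(R)) = \big\{\lambda_1^{[5]},\lambda_2^{[1]},\lambda_3^{[3]},\lambda_4^{[3]},\lambda_5^{[1]},\lambda_6^{[1]},0^{[p^4-(p-1)^4-2^4+1]}\big\}.$$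
   Context: $\mathbb Z_p$ denotes the ring of integers modulo $p$. For a finite commutative ring $R$ with $1\ne0$, the zero-divisor graph $\Gamma(R)$ has as vertex set the set of non-zero zero-divisors of $R$, and two (not necessarily distinct) vertices $x,y$ are adjacent iff $xy=0$ (loops are kept). The spectrum of a graph is the multiset of eigenvalues of its adjacency matrix; $\lambda^{[m]}$ means that $\lambda$ occurs with multiplicity $m$ (and $0^{[0]}$ means that $0$ does not occur). *)

(* Defs.v *)
From HB Require Import structures.
From mathcomp Require Import all_boot all_order all_algebra.

Set Implicit Arguments.
Unset Strict Implicit.
Unset Printing Implicit Defensive.

Import Order.TTheory GRing.Theory Num.Theory.

Local Open Scope ring_scope.

Definition ring_isomorphic (R S : nzRingType) : Prop :=
  exists f : {rmorphism R -> S}, bijective f.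

Section Spectrum.

(* A finite graph, loops allowed, is a finType V with an adjacency relation;
   a loop at x contributes a diagonal entry 1. *)
Definition adjacency_matrix (F : nzRingType) (V : finType) (adj : rel V) :
    'M[F]_#|V| :=
  \matrix_(i, j) (adj (enum_val i) (enum_val j))%:R.

Variables (F : closedFieldType) (n : nat).

(* The eigenvalues listed with their algebraic multiplicities. The order of the
   list is unspecified, so spectra are to be compared with perm_eq. *)
Definition spectrum (A : 'M[F]_n) : seq F :=
  sval (closed_field_poly_normal (char_poly A)).

Lemma char_poly_spectrum (A : 'M[F]_n) :
  char_poly A = \prod_(x <- spectrum A) ('X - x%:P).
Proof.
rewrite /spectrum; case: closed_field_poly_normal => r /= {1}->.
by rewrite (monicP (char_poly_monic A)) scale1r.
Qed.

Lemma mem_spectrum (A : 'M[F]_n) (x : F) :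
  (x \in spectrum A) = eigenvalue A x.
Proof. by rewrite eigenvalue_root_char char_poly_spectrum root_prod_XsubC. Qed.

Lemma size_spectrum (A : 'M[F]_n) : size (spectrum A) = n.
Proof.
by apply: succn_inj; rewrite -(size_char_poly A) char_poly_spectrum
  size_prod_XsubC.
Qed.

End Spectrum.

Section ZeroDivisorGraph.

Variable R : finComNzRingType.

Definition zero_divisor (x : R) : bool :=
  [exists y : R, (y != 0) && (x * y == 0)].

Definition zdg_vertex : finType := {x : R | (x != 0) && zero_divisor x}.

Definition zdg_adj : rel zdg_vertex := fun x y => val x * val y == 0.

Definition zdg_spectrum (C : closedFieldType) : seq C :=
  spectrum (adjacency_matrix C zdg_adj).

End ZeroDivisorGraph.

(* Main.v *)
(* R is a product of four copies of a field, so a vertex of the graph matters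
   only through its support, a subset of {1,2,3,4} of size 1, 2 or 3, and adjacency is
   disjointness of supports; a support T is shared by (p-1)^|T| vertices. Since
   S_4 acts on the supports, the adjacency matrix splits into six mutually
   annihilating symmetric pieces of the form K E K^T with K of width 3, one for
   each vector of an S_4-adapted orthogonal basis. Mutual annihilation makes the
   characteristic polynomials multiply, up to powers of X, and exchanging the
   factors K and E K^T reduces each of them to a 3 x 3 determinant. *)

Require Import Defs.
From HB Require Import structures.
From mathcomp Require Import all_boot all_order all_algebra ring zify.

Set Implicit Arguments.
Unset Strict Implicit.
Unset Printing Implicit Defensive.

Import Order.TTheory GRing.Theory Num.Theory.

Local Open Scope ring_scope.

(** * Characteristic polynomials of matrix products and annihilating sums *)

(** Sylvester's identity: one block matrix becomes triangular either by clearing [L] or by clearing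
    [K]. No division occurs, so it applies over polynomial rings. *)
Lemma det_scalar_sub_mulmxC (R : comNzRingType) (n m : nat)
    (a : R) (K : 'M[R]_(n, m)) (L : 'M[R]_(m, n)) :
  \det (a%:M - K *m L) * a ^+ m = a ^+ n * \det (a%:M - L *m K).
Proof.
pose M := block_mx a%:M K L 1%:M.
have detM1 : \det M = \det (a%:M - K *m L).
  have <- : \det (M *m block_mx 1%:M 0 (- L) 1%:M) = \det (a%:M - K *m L).
    rewrite mulmx_block !mulmx1 !mulmx0 !mulmxN !mul1mx subrr !add0r.
    by rewrite det_ublock det1 mulr1.
  by rewrite det_mulmx det_lblock !det1 !mulr1.
rewrite -detM1.
have <- : \det (M *m block_mx 1%:M (- K) 0 a%:M)
    = a ^+ n * \det (a%:M - L *m K).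
  rewrite mulmx_block !mulmx1 !mulmx0 !mulmxN !mul1mx !addr0.
  by rewrite mul_scalar_mx mul_mx_scalar addNr det_lblock det_scalar addrC.
by rewrite det_mulmx det_ublock det1 mul1r det_scalar.
Qed.

Lemma char_poly_mulmxC (R : comNzRingType) (n m : nat)
    (K : 'M[R]_(n, m)) (L : 'M[R]_(m, n)) :
  char_poly (K *m L) * 'X^m = 'X^n * char_poly (L *m K).
Proof. by rewrite /char_poly /char_poly_mx !map_mxM det_scalar_sub_mulmxC. Qed.

(* If A B = 0 then (X - A)(X - B) = X (X - (A + B)). *)
Lemma char_poly_add_annihilating (R : comNzRingType) (n : nat)
    (A B : 'M[R]_n) :
  A *m B = 0 -> char_poly A * char_poly B = 'X^n * char_poly (A + B).
Proof.
move=> AB0; rewrite /char_poly -det_mulmx -det_scalar -det_mulmx.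
congr (\det _); rewrite /char_poly_mx mulmxBl !mulmxBr -map_mxM AB0 map_mx0.
rewrite subr0 map_mxD !mul_scalar_mx mul_mx_scalar scalerDr opprD addrA.
by rewrite addrAC.
Qed.

Lemma char_poly_sum_annihilating (R : comNzRingType) (n r : nat)
    (A : 'I_r -> 'M[R]_n) :
  (forall i j, i != j -> A i *m A j = 0) ->
  \prod_i char_poly (A i) * 'X^n = 'X^(r * n) * char_poly (\sum_i A i).
Proof.
elim: r A => [|r IHr] A A0.
  rewrite !big_ord0 mul1r mul0n mul1r /char_poly /char_poly_mx map_mx0 subr0.
  by rewrite det_scalar.
rewrite !big_ord_recl -mulrA IHr; last first.
  by move=> i j ij; apply: A0; rewrite (inj_eq lift_inj).
rewrite mulrCA char_poly_add_annihilating.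
  by rewrite mulrA -exprD mulSn addnC.
rewrite mulmx_sumr big1 // => i _; apply: A0.
by rewrite -(inj_eq val_inj).
Qed.

Lemma det_mx33 (R : comNzRingType) (A : 'M[R]_3) :
  let a i j := A (inord i) (inord j) in
  \det A = a 0%N 0%N * (a 1%N 1%N * a 2%N 2%N - a 1%N 2%N * a 2%N 1%N)
         - a 0%N 1%N * (a 1%N 0%N * a 2%N 2%N - a 1%N 2%N * a 2%N 0%N)
         + a 0%N 2%N * (a 1%N 0%N * a 2%N 1%N - a 1%N 1%N * a 2%N 0%N).
Proof.
move=> a; have aE i j : A i j = a i j by rewrite /a !inord_val.
rewrite (expand_det_row _ ord0) !big_ord_recl big_ord0 /cofactor.
rewrite !(expand_det_row _ ord0) !big_ord_recl !big_ord0 /cofactor !det_mx11.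
rewrite !mxE !aE /= /bump /=; ring.
Qed.

(** Supports of sizes k and l with k + l > 4 always meet, which gives the 3 x 3 matrices below this
    anti-triangular shape. *)
Lemma char_poly_antitriangular33 (R : comNzRingType) (A : 'M[R]_3)
    (a b c d e f : R) :
  (forall i j : 'I_3, A i j =
     nth 0 (nth [::] [:: [:: a; b; c]; [:: d; e; 0]; [:: f; 0; 0]] i) j) ->
  char_poly A = 'X^3 - (a + e)%:P * 'X^2
    + (a * e - b * d - c * f)%:P * 'X + (c * e * f)%:P.
Proof.
move=> AE; rewrite /char_poly det_mx33 /char_poly_mx !mxE !AE -!val_eqE /=.
rewrite !inordK //=.
rewrite !(rmorphD, rmorphN, rmorphM) /=; ring.
Qed.

(** * Supports and the harmonic basis *)

(** Boolean quadruples rather than sets, so that finite checks on supports reduce to computation. *)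
Definition cube : finType := (bool * bool * bool * bool)%type.

Definition weight (T : cube) : nat :=
  let: (a, b, c, d) := T in (a + b + c + d)%N.

Definition cube_disjoint (T U : cube) : bool :=
  let: (a, b, c, d) := T in let: (a', b', c', d') := U in
  [&& ~~ (a && a'), ~~ (b && b'), ~~ (c && c') & ~~ (d && d')].

(* The supports of the non-zero zero-divisors. *)
Definition middle (T : cube) : bool := (0 < weight T < 4)%N.

(* The S_4-module of functions on the subsets of size k = 1, 2, 3 is a sum of
   the trivial module, of the standard one and, for k = 2, of the
   two-dimensional one; here are orthogonal vectors for these modules, written
   as functions on the cube that do not depend on k. *)
Definition harmonic (i : nat) (T : cube) : int :=
  let: (a, b, c, d) := T in
  let: (a, b, c, d) := (a%:Z, b%:Z, c%:Z, d%:Z) in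
  nth 0 [:: 1; a + b - c - d; a - b + c - d; a - b - c + d;
            a * b + c * d - a * c - b * d;
            a * b + c * d + a * c + b * d - 2 * (a * d + b * c)] i.

(* The components of the disjointness relation on these modules, times 24. *)
Definition harmonic_coef (i : nat) : seq (seq int) :=
  let std := [:: [:: -6; -6; -6]; [:: -6; -3; 0]; [:: -6; 0; 0]] in
  nth [::] [:: [:: [:: 18; 12; 6]; [:: 12; 4; 0]; [:: 6; 0; 0]];
               std; std; std;
               [:: [:: 0; 0; 0]; [:: 0; 6; 0]; [:: 0; 0; 0]];
               [:: [:: 0; 0; 0]; [:: 0; 2; 0]; [:: 0; 0; 0]]] i.

(** Entry k belongs to the restriction of [harmonic i] to supports of size k+1; a zero means that
    this restriction vanishes. *)
Definition harmonic_sqnorm (i : nat) : seq int :=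
  nth [::] [:: [:: 4; 6; 4]; [:: 4; 8; 4]; [:: 4; 8; 4]; [:: 4; 8; 4];
               [:: 0; 4; 0]; [:: 0; 12; 0]] i.

(** The factor 24 clears denominators, which makes this an identity of integers decidable by
    evaluation on all 256 pairs. *)
Lemma disjoint_harmonicE (T U : cube) : middle T -> middle U ->
  24 * (cube_disjoint T U)%:R = \sum_(i < 6) \sum_(k < 3) \sum_(l < 3)
    (weight T == k.+1)%:R * harmonic i T
    * nth 0 (nth [::] (harmonic_coef i) k) l
    * ((weight U == l.+1)%:R * harmonic i U) :> int.
Proof.
move=> mT mU; apply/eqP; apply/implyP: mU; apply/implyP: mT.
rewrite !big_ord_recl !big_ord0; case: T U => [[[a b] c] d] [[[a' b'] c'] d'].
by case: a b c d a' b' c' d' => [] [] [] [] [] [] [] []; vm_compute.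
Qed.

Lemma big_cube (R : nmodType) (F : cube -> R) :
  \sum_T F T = \sum_(a : bool) \sum_(b : bool) \sum_(c : bool) \sum_(d : bool)
                 F (a, b, c, d).
Proof.
by rewrite !pair_bigA; apply: eq_bigr => -[[[a b] c] d].
Qed.

(** Orthogonality holds at each size separately, hence survives weighting each size by its own power
    of p-1. *)
Lemma harmonic_orthogonal (i j : 'I_6) (k : 'I_3) :
  \sum_T (weight T == k.+1)%:R * (harmonic i T * harmonic j T)
  = if i == j then nth 0 (harmonic_sqnorm i) k else 0 :> int.
Proof.
rewrite big_cube !big_bool; apply/eqP; rewrite -val_eqE.
by case: i j k =>
  [[|[|[|[|[|[|//]]]]]] ?] [[|[|[|[|[|[|//]]]]]] ?] [[|[|[|//]]] ?].
Qed.

(** * Fibres of the support map *)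

(* [w a] is the size of the fibre of [s] over [a]. *)
Definition weighted_image (X A : finType) (s : X -> A) (w : A -> nat) : Prop :=
  forall (M : nmodType) (F : A -> M), \sum_x F (s x) = \sum_a F a *+ w a.

Lemma weighted_image_prod (X Y A B : finType) (s : X -> A) (t : Y -> B) v w :
  weighted_image s v -> weighted_image t w ->
  weighted_image (fun z : X * Y => (s z.1, t z.2))
                 (fun c : A * B => v c.1 * w c.2)%N.
Proof.
move=> sv tw M F; rewrite -(pair_bigA _ (fun x y => F (s x, t y))) /=.
rewrite (sv M (fun a => \sum_y F (a, t y))).
transitivity (\sum_a \sum_b F (a, b) *+ (v a * w b)); last first.
  by rewrite pair_bigA; apply: eq_bigr => -[].
apply: eq_bigr => a _; rewrite (tw M (fun b => F (a, b))) -sumrMnl.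
by apply: eq_bigr => b _; rewrite mulnC mulrnA.
Qed.

Lemma weighted_image_inj (X Y A : finType) (f : Y -> X) (s : X -> A) w :
  bijective f -> weighted_image s w -> weighted_image (s \o f) w.
Proof.
move=> fbij sw M F; rewrite -sw (reindex f) //=.
exact: onW_bij.
Qed.

Lemma weighted_image_Zp (p : nat) : prime p ->
  weighted_image (fun x : 'Z_p => x != 0) (fun b => if b then p.-1 else 1%N).
Proof.
move=> p_pr M F; rewrite big_bool (bigD1 0) //= mulr1n [RHS]addrC.
congr (_ + _); under eq_bigr => x -> do [].
by rewrite sumr_const cardC1 card_ord Zp_cast ?prime_gt1.
Qed.

Lemma Zp_mulf_eq0 (p : nat) (x y : 'Z_p) : prime p ->
  (x * y == 0) = (x == 0) || (y == 0).
Proof.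
(* For prime [p] the type ['Z_p] rewrites to the field ['F_p]. *)
by move=> p_pr; move: x y; rewrite -Fp_Zcast // => x y; apply: (@mulf_eq0 'F_p).
Qed.

Definition zsupport (p : nat) (x : 'Z_p * 'Z_p * 'Z_p * 'Z_p) : cube :=
  (x.1.1.1 != 0, x.1.1.2 != 0, x.1.2 != 0, x.2 != 0).

Lemma zsupport_weighted_image (p : nat) : prime p ->
  weighted_image (@zsupport p) (fun T => p.-1 ^ weight T)%N.
Proof.
move=> p_pr M F; have Zp := weighted_image_Zp p_pr.
have /(_ M F) -> :=
  weighted_image_prod (weighted_image_prod (weighted_image_prod Zp Zp) Zp) Zp.
apply: eq_bigr => -[[[a b] c] d] _ /=; rewrite !expnD.
by case: a b c d => [] [] [] [].
Qed.

Lemma zsupport_mul_eq0 (p : nat) (x y : 'Z_p * 'Z_p * 'Z_p * 'Z_p) : prime p ->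
  (x * y == 0) = cube_disjoint (zsupport x) (zsupport y).
Proof.
move=> p_pr; case: x y => [[[a b] c] d] [[[a' b'] c'] d'].
rewrite /zsupport /= !negb_and !negbK -!Zp_mulf_eq0 //.
by rewrite !xpair_eqE /= !andbA.
Qed.

Lemma zsupport_eq0 (p : nat) (x : 'Z_p * 'Z_p * 'Z_p * 'Z_p) :
  (x == 0) = (weight (zsupport x) == 0%N).
Proof.
case: x => [[[a b] c] d]; rewrite !xpair_eqE /= /zsupport /=.
by do 4!case: eqP => //=.
Qed.

(** * Characteristic polynomial of the disjointness graph *)

(** Here q stands for p-1. The two-dimensional module lives on size 2 only, whence the factor X^2 in
    [two]. *)
Definition zdg_factor (C : numFieldType) (q : C) (i : nat) : {poly C} :=
  let trv :=
    ('X + (q ^+ 2)%:P) * ('X^2 - (2 * q ^+ 2 + 3 * q)%:P * 'X + (q ^+ 4)%:P) in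
  let std :=
    ('X - (q ^+ 2)%:P) * ('X^2 + (2 * q ^+ 2 + q)%:P * 'X + (q ^+ 4)%:P) in
  let two := ('X - (q ^+ 2)%:P) * 'X^2 in
  nth 0 [:: trv; std; std; std; two; two] i.

Lemma char_poly_zdg_factor (C : numFieldType) (q : C) (i : 'I_6) (D : 'M[C]_3) :
  (forall k l, D k l =
     (nth 0 (nth [::] (harmonic_coef i) k) l)%:~R / 24
     * (q ^+ l.+1 * (nth 0 (harmonic_sqnorm i) l)%:~R)) ->
  char_poly D = zdg_factor q i.
Proof.
move=> DE; pose x k l := (nth 0 (nth [::] (harmonic_coef i) k) l)%:~R / 24
     * (q ^+ l.+1 * (nth 0 (harmonic_sqnorm i) l)%:~R).
have n24 : 24 != 0 :> C by rewrite pnatr_eq0.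
have combine a b c d e f s t u : a + e = s -> a * e - b * d - c * f = t ->
    c * e * f = u ->
    'X^3 - (a + e)%:P * 'X^2 + (a * e - b * d - c * f)%:P * 'X
      + (c * e * f)%:P = 'X^3 - s%:P * 'X^2 + t%:P * 'X + u%:P :> {poly C}.
  by move=> -> -> ->.
rewrite (@char_poly_antitriangular33 _ _
  (x 0 0) (x 0 1) (x 0 2) (x 1 0) (x 1 1) (x 2 0))%N; last first.
  move=> k l; rewrite DE -/(x k l).
  case: i @x DE => [[|[|[|[|[|[|//]]]]]] ?] x DE;
  by case: k l => [[|[|[|//]]] ?] [[|[|[|//]]] ?] //=; rewrite /x /= !mul0r.
(* The lists hold the trace, the sum of the principal 2 x 2 minors and minus the determinant; the
   last two default to 0 for the two-dimensional module. *)
rewrite (combine _ _ _ _ _ _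
  (nth 0 [:: q ^+ 2 + 3 * q; - q ^+ 2 - q; - q ^+ 2 - q; - q ^+ 2 - q;
             q ^+ 2; q ^+ 2] i)
  (nth 0 [:: - q ^+ 4 - 3 * q ^+ 3; - q ^+ 4 - q ^+ 3; - q ^+ 4 - q ^+ 3;
             - q ^+ 4 - q ^+ 3] i)
  (nth 0 [:: q ^+ 6; - q ^+ 6; - q ^+ 6; - q ^+ 6] i)).
- rewrite /zdg_factor; clear DE x combine.
  case: i => [[|[|[|[|[|[|//]]]]]] ?] /=;
  by rewrite !(rmorphD, rmorphN, rmorphM, rmorphXn, rmorph_nat, rmorph0) /=; ring.
- rewrite /x; clear DE x combine.
  by case: i => [[|[|[|[|[|[|//]]]]]] ?] /=; field.
- rewrite /x; clear DE x combine.
  by case: i => [[|[|[|[|[|[|//]]]]]] ?] /=; field.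
rewrite /x; clear DE x combine.
by case: i => [[|[|[|[|[|[|//]]]]]] ?] /=; field.
Qed.

(** Each of the six exchanges of factors costs X^3, the width of [K i]; hence X^18. *)
Lemma char_poly_disjointness (C : numFieldType) (V : finType) (adj : rel V)
    (t : V -> cube) (q : nat) :
  (forall v, middle (t v)) ->
  (forall v w, adj v w = cube_disjoint (t v) (t w)) ->
  (forall F : cube -> C,
     \sum_v F (t v) = \sum_(T | middle T) F T *+ q ^ weight T) ->
  char_poly (adjacency_matrix C adj) * 'X^18
  = 'X^#|V| * \prod_(i < 6) zdg_factor q%:R i.
Proof.
move=> t_mid adjE tsum; set n := #|V|; set A := adjacency_matrix C adj.
pose tv (i : 'I_n) := t (enum_val i).
pose K (i : 'I_6) : 'M[C]_(n, 3) := \matrix_(x, k)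
  ((weight (tv x) == k.+1)%:R * harmonic i (tv x))%:~R.
pose E (i : 'I_6) : 'M[C]_3 := \matrix_(k, l)
  ((nth 0 (nth [::] (harmonic_coef i) k) l)%:~R / 24).
have n24 : 24 != 0 :> C by rewrite pnatr_eq0.
have AE : A = \sum_i K i *m (E i *m (K i)^T).
  apply/matrixP => x y; rewrite mxE adjE summxE.
  have /(congr1 (fun z : int => z%:~R : C)) :=
    disjoint_harmonicE (t_mid (enum_val x)) (t_mid (enum_val y)).
  rewrite rmorphM rmorph_sum /= !mulrz_nat => /(canRL (mulKf n24)) ->.
  rewrite mulr_sumr; apply: eq_bigr => i _.
  rewrite rmorph_sum mulr_sumr mxE; apply: eq_bigr => k _.
  rewrite rmorph_sum mulr_sumr !mxE mulr_sumr; apply: eq_bigr => l _.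
  by rewrite !mxE !rmorphM /= -/(tv x) -/(tv y); field.
(* The Gram matrices serve twice: for i != j they give annihilation, for i = j the 3 x 3 matrix
   after the exchange. *)
have KK i j : (K i)^T *m K j = if i == j then
    diag_mx (\row_k (q%:R ^+ k.+1 * (nth 0 (harmonic_sqnorm i) k)%:~R)) else 0.
  apply/matrixP => k l; rewrite mxE.
  transitivity (\sum_T ((weight T == k.+1)%:R * harmonic i T
      * ((weight T == l.+1)%:R * harmonic j T))%:~R * q%:R ^+ weight T : C).
    under eq_bigr => x _ do rewrite !mxE -rmorphM /= /tv.
    rewrite -(big_enum_val (A := V)
      (fun v => ((weight (t v) == k.+1)%:R * harmonic i (t v)
      * ((weight (t v) == l.+1)%:R * harmonic j (t v)))%:~R)).
    rewrite (tsum (fun T => ((weight T == k.+1)%:R * harmonic i T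
      * ((weight T == l.+1)%:R * harmonic j T))%:~R)).
    rewrite big_mkcond; apply: eq_bigr => T _; rewrite -natrX mulr_natr.
    (* Outside [middle] the term vanishes, since weight k+1 with k < 3 would put [T] inside. *)
    case: ifPn => //; rewrite /middle; case: eqP => [-> | _ _]; last first.
      by rewrite !mul0r mul0rn.
    by case: k => -[|[|[]]].
  have [<-{l}|kl] := eqVneq k l; last first.
    rewrite big1 => [|T _]; last first.
      case: eqP => [->|_]; last by rewrite !mul0r.
      by rewrite eqSS (negPf (kl : k != l :> nat)) mul0r mulr0 mul0r.
    by case: ifP => _; rewrite !mxE // (negPf kl).
  transitivity (q%:R ^+ k.+1 * (\sum_T (weight T == k.+1)%:R
      * (harmonic i T * harmonic j T))%:~R : C).
    rewrite rmorph_sum mulr_sumr; apply: eq_bigr => T _.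
    by case: eqP => [->|_]; rewrite ?mul0r ?mulr0 // !mul1r mulrC.
  by rewrite harmonic_orthogonal; case: eqP; rewrite !mxE ?eqxx ?mulr0.
have A0 i j : i != j ->
    (K i *m (E i *m (K i)^T)) *m (K j *m (E j *m (K j)^T)) = 0.
  move=> ij; rewrite -!mulmxA [(K i)^T *m _]mulmxA KK (negPf ij).
  by rewrite mul0mx !mulmx0.
have := char_poly_sum_annihilating A0; rewrite -AE => charA.
(* This power matches the one in [charA]; one X^n and one X^3 then go to each of the six factors. *)
apply: (@mulfI _ ('X^(6 * n))); first by rewrite monic_neq0 ?monicXn.
rewrite mulrA -charA mulrAC.
have X18 : 'X^18 = \prod_(i < 6) 'X^3 :> {poly C}.
  by rewrite big_const_ord iter_mulr_1 -exprM.
rewrite X18 -big_split /= mulrC mulrCA; congr (_ * _).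
have -> : 'X^(6 * n) = \prod_(i < 6) 'X^n :> {poly C}.
  by rewrite big_const_ord iter_mulr_1 -exprM mulnC.
rewrite -big_split; apply: eq_bigr => i _ /=.
rewrite char_poly_mulmxC; congr (_ * _); apply: char_poly_zdg_factor => k l.
by rewrite -mulmxA KK eqxx mul_mx_diag !mxE.
Qed.

(** * Vertices of the zero-divisor graph *)

(** If nothing maps to [a], summing the indicator of [a] gives 0 = [w a]. *)
Lemma weighted_image_surj (X A : finType) (s : X -> A) w (a : A) :
  weighted_image s w -> (0 < w a)%N -> exists x, s x = a.
Proof.
move=> sw wa; have [x /eqP sx|sNa] := pickP (fun x => s x == a).
  by exists x.
have /= := sw nat (fun b => (b == a) : nat).
rewrite big1 => [|x _]; last by rewrite sNa.
rewrite (bigD1 a) //= eqxx big1 => [|b /negPf->]; last exact: mul0rn.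
by rewrite addr0 -mulr_natr mul1r natn => wa0; rewrite -wa0 in wa.
Qed.

Lemma zero_divisor_middle (R : finComNzRingType) (s : R -> cube) (q : nat) :
  (0 < q)%N -> weighted_image s (fun T => q ^ weight T)%N ->
  (forall x, (x == 0) = (weight (s x) == 0%N)) ->
  (forall x y, (x * y == 0) = cube_disjoint (s x) (s y)) ->
  forall x, (x != 0) && zero_divisor x = middle (s x).
Proof.
move=> q_gt0 sw s0 sM x; rewrite s0 -lt0n /middle; congr (_ && _).
apply/existsP/idP => [[y /andP[]]|].
  rewrite s0 sM; case: (s x) (s y) => [[[a b] c] d] [[[a' b'] c'] d'].
  by case: a b c d a' b' c' d' => [] [] [] [] [] [] [] [].
(* An element with the complementary support annihilates [x], and is non-zero because [s x] is not
   full. *)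
pose U : cube := let: (a, b, c, d) := s x in (~~ a, ~~ b, ~~ c, ~~ d).
have [|y sy] := weighted_image_surj (a := U) sw; first by rewrite expn_gt0 q_gt0.
move=> xlt; exists y; rewrite s0 sM sy; move: xlt; rewrite /U.
by case: (s x) => [[[[] []] []] []].
Qed.

Lemma sum_zdg_vertex (R : finComNzRingType) (s : R -> cube) (w : cube -> nat)
    (M : nmodType) (F : cube -> M) :
  weighted_image s w ->
  (forall x, (x != 0) && zero_divisor x = middle (s x)) ->
  \sum_(v : zdg_vertex R) F (s (val v)) = \sum_(T | middle T) F T *+ w T.
Proof.
move=> sw vE.
rewrite -(big_sub (fun x => (x != 0) && zero_divisor x) (fun x => F (s x))).
rewrite (eq_bigl _ _ vE) [LHS]big_mkcond [RHS]big_mkcond /=.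
rewrite (sw M (fun T => if middle T then F T else 0)).
by apply: eq_bigr => T _; case: ifP; rewrite ?mul0rn.
Qed.

Lemma card_middle (q : nat) :
  (\sum_(T | middle T) q ^ weight T = 4 * q + 6 * q ^ 2 + 4 * q ^ 3)%N.
Proof.
rewrite big_mkcond.
rewrite (big_cube (fun T => if middle T then q ^ weight T else 0)%N).
by rewrite !big_bool /=; lia.
Qed.

(** * Explicit eigenvalues and multiplicities *)

(** By Vieta, [l3], [l4] are the roots of the quadratic in [std] and [l5], [l6] of that in [trv].
    The five [l1] come from three [std] and two [two], and the latter also give X^4. *)
Lemma prod_zdg_factor (C : numClosedFieldType) (P : C) :
  let l1 := (P - 1) ^+ 2 in
  let l2 := - P ^+ 2 + 2 * P - 1 in
  let l3 := (- 2 * P ^+ 2 + 3 * P - 1 + (P - 1) * sqrtC (4 * P - 3)) / 2 in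
  let l4 := (- 2 * P ^+ 2 + 3 * P - 1 - (P - 1) * sqrtC (4 * P - 3)) / 2 in
  let l5 := (2 * P ^+ 2 - P - 1
             + sqrtC 3 * sqrtC (4 * P ^+ 3 - 9 * P ^+ 2 + 6 * P - 1)) / 2 in
  let l6 := (2 * P ^+ 2 - P - 1
             - sqrtC 3 * sqrtC (4 * P ^+ 3 - 9 * P ^+ 2 + 6 * P - 1)) / 2 in
  \prod_(i < 6) zdg_factor (P - 1) i = 'X^4 *
    \prod_(x <- nseq 5 l1 ++ nseq 1 l2 ++ nseq 3 l3 ++ nseq 3 l4 ++ nseq 1 l5
                ++ nseq 1 l6) ('X - x%:P).
Proof.
move=> l1 l2 l3 l4 l5 l6.
have XsubC2 (x y : C) :
    ('X - x%:P) * ('X - y%:P) = 'X^2 - (x + y)%:P * 'X + (x * y)%:P.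
  by rewrite rmorphD rmorphM /=; ring.
have e34 : ('X - l3%:P) * ('X - l4%:P)
    = 'X^2 + (2 * (P - 1) ^+ 2 + (P - 1))%:P * 'X + ((P - 1) ^+ 4)%:P.
  have s : l3 + l4 = - (2 * (P - 1) ^+ 2 + (P - 1)) by rewrite /l3 /l4; field.
  have <- : l3 * l4 = (P - 1) ^+ 4.
    transitivity (((- 2 * P ^+ 2 + 3 * P - 1) ^+ 2
        - (P - 1) ^+ 2 * sqrtC (4 * P - 3) ^+ 2) / 4).
      by rewrite /l3 /l4; field.
    by rewrite sqrtCK; field.
  by rewrite XsubC2 s polyCN mulNr opprK.
have e56 : ('X - l5%:P) * ('X - l6%:P)
    = 'X^2 - (2 * (P - 1) ^+ 2 + 3 * (P - 1))%:P * 'X + ((P - 1) ^+ 4)%:P.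
  have <- : l5 + l6 = 2 * (P - 1) ^+ 2 + 3 * (P - 1) by rewrite /l5 /l6; field.
  have <- : l5 * l6 = (P - 1) ^+ 4.
    transitivity (((2 * P ^+ 2 - P - 1) ^+ 2 - sqrtC 3 ^+ 2
        * sqrtC (4 * P ^+ 3 - 9 * P ^+ 2 + 6 * P - 1) ^+ 2) / 4).
      by rewrite /l5 /l6; field.
    by rewrite !sqrtCK; field.
  exact: XsubC2.
rewrite !big_ord_recl big_ord0 !big_cat !big_nseq /= /zdg_factor /=.
rewrite -e34 -e56 -/l1.
have -> : l2 = - l1 by rewrite /l1 /l2; ring.
rewrite rmorphN /=; move: l1 l3 l4 l5 l6 {XsubC2 e34 e56} => l1 l3 l4 l5 l6; ring.
Qed.

(** After cancelling X^k, the remaining X^m accounts for m zeros, and monic linear factorisations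
    are unique up to order. *)
Lemma perm_eq_prod_XsubC_nseq0 (F : fieldType) (s t : seq F) (m k : nat) :
  \prod_(x <- s) ('X - x%:P) * 'X^k
    = 'X^(m + k) * \prod_(x <- t) ('X - x%:P) ->
  perm_eq s (t ++ nseq m 0).
Proof.
move=> st; apply: prod_XsubC_eq; rewrite big_cat big_nseq iter_mulr_1 subr0 /=.
apply: (@mulIf _ 'X^k); first by rewrite monic_neq0 ?monicXn.
by rewrite st exprD mulrC mulrA.
Qed.

Theorem mainTheorem8 (C : numClosedFieldType) (p : nat) (hp : prime p)
    (R : finComNzRingType)
    (hR : ring_isomorphic R ('Z_p * 'Z_p * 'Z_p * 'Z_p)%type) :
  let P : C := p%:R in
  let l1 := (P - 1) ^+ 2 in
  let l2 := - P ^+ 2 + 2 * P - 1 in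
  let l3 := (- 2 * P ^+ 2 + 3 * P - 1 + (P - 1) * sqrtC (4 * P - 3)) / 2 in
  let l4 := (- 2 * P ^+ 2 + 3 * P - 1 - (P - 1) * sqrtC (4 * P - 3)) / 2 in
  let l5 := (2 * P ^+ 2 - P - 1
             + sqrtC 3 * sqrtC (4 * P ^+ 3 - 9 * P ^+ 2 + 6 * P - 1)) / 2 in
  let l6 := (2 * P ^+ 2 - P - 1
             - sqrtC 3 * sqrtC (4 * P ^+ 3 - 9 * P ^+ 2 + 6 * P - 1)) / 2 in
  perm_eq (zdg_spectrum R C)
    (nseq 5 l1 ++ nseq 1 l2 ++ nseq 3 l3 ++ nseq 3 l4 ++ nseq 1 l5 ++ nseq 1 l6
     ++ nseq ((p ^ 4 + 1) - ((p - 1) ^ 4 + 2 ^ 4))%N 0).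
Proof.
case: hR => f f_bij.
pose s x := zsupport (f x); have p_gt1 := prime_gt1 hp.
have q_gt0 : (0 < p.-1)%N by lia.
have sw : weighted_image s (fun T => p.-1 ^ weight T)%N.
  exact: weighted_image_inj f_bij (zsupport_weighted_image hp).
have s0 x : (x == 0) = (weight (s x) == 0%N).
  by rewrite -zsupport_eq0 -(inj_eq (bij_inj f_bij)) rmorph0.
have sM x y : (x * y == 0) = cube_disjoint (s x) (s y).
  by rewrite -zsupport_mul_eq0 // -(inj_eq (bij_inj f_bij)) rmorph0 rmorphM.
have vE := zero_divisor_middle q_gt0 sw s0 sM.
have cardV : #|zdg_vertex R| = (4 * p.-1 + 6 * p.-1 ^ 2 + 4 * p.-1 ^ 3)%N.
  rewrite -card_middle -sum1_card (sum_zdg_vertex (fun _ => 1%N : nat) sw vE).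
  by apply: eq_bigr => T _; rewrite -mulr_natr mul1r natn.
have charE := char_poly_disjointness
  (adj := @zdg_adj R) (t := fun v => s (val v))
  (fun v => etrans (esym (vE (val v))) (valP v)) (fun v w => sM (val v) (val w))
  (fun F : cube -> C => sum_zdg_vertex F sw vE).
move: charE; have -> : p.-1%:R = p%:R - 1 :> C.
  by rewrite -subn1 natrB // ltnW.
rewrite prod_zdg_factor char_poly_spectrum -/(zdg_spectrum R C) cardV.
set z := (_ - _)%N.
(* There are 14 = 5+1+3+3+1+1 listed eigenvalues besides the [z] zeros. The subtraction in [z] never
   truncates, as [z] is 0 already at p = 2. With X^4 the exponent becomes z + 18, matching X^18. *)
have -> : (4 * p.-1 + 6 * p.-1 ^ 2 + 4 * p.-1 ^ 3 = z + 14)%N.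
  by rewrite /z -(prednK (prime_gt0 hp)) /=; lia.
rewrite ['X^_ * ('X^4 * _)]mulrA -exprD -addnA.
by move=> /perm_eq_prod_XsubC_nseq0; rewrite -!catA.
Qed.
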